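(* There exist universal constants $A_0,C,c>0$ such that the following holds. Let $X\in\mathbb R^{n\times p}$, $\varrho\ge\|X\|_2$ with $\varrho>0$, $l(\beta)=l_0(X\beta)$ directionally differentiable, $\Theta$ a thresholding function with associated penalty $P_\Theta$ and number $\mathcal L_\Theta$, and $\psi:\mathbb R^p\to\mathbb R$ any directionally differentiable function. Let $\beta^*\in\mathbb R^p$ be such that $l_0$ is differentiable at $X\beta^*$ and the effective noise $\epsilon=-\nabla l_0(X\beta^* )$ is a sub-Gaussian random vector with mean zero and scale bounded by $\sigma$. Suppose there exist $\delta>0$, $\vartheta>0$ and (large enough) $K\ge 0$ such that for any $\beta\in\mathbb R^p$ $$\varrho^2\mathcal L_\Theta\mathbf D_2(\beta,\beta^* )+\delta\mathbf D_2(X\beta,X\beta^* )+\vartheta P_H(\varrho(\beta-\beta^* );\lambda)+P_\Theta(\varrho\beta^*;\lambda)\le 2\bar{\mathbf\Delta}_l(\beta,\beta^* )+P_\Theta(\varrho\beta;\lambda)+K\lambda^2J(\beta^* ),$$ where $\lambda=A\sigma\sqrt{\log(ep)}/\sqrt{(\delta\wedge\vartheta)\vartheta}$ with $A\ge A_0$. Let $\hat\beta$ be any fixed point of the surrogate, i.e. $$\hat\beta\in\mathop{\arg\min}_{\beta}\ g(\beta;\hat\beta),\qquad g(\beta;\beta^-)=l(\beta)+P_\Theta(\varrho\beta;\lambda)+\mathbf\Delta_\psi(\beta,\beta^-).$$ Then, with probability at least $1-Cp^{-cA^2}$, $$\mathbf D_2(X\hat\beta,X\beta^* )\le\frac{2KA^2}{(\delta\wedge\vartheta)\delta\vartheta}\sigma^2J(\beta^*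 )\log(ep),$$ $$P_H(\varrho(\hat\beta-\beta^* );\lambda)\le\frac{4KA^2}{(\delta\wedge\vartheta)\vartheta^2}\sigma^2J(\beta^* )\log(ep).$$
   Context: Directional derivative: $\delta\psi(\beta;h)=\lim_{\epsilon\to0+}[\psi(\beta+\epsilon h)-\psi(\beta)]/\epsilon$; $\psi$ is directionally differentiable if this exists and is finite for all $\beta,h$. Generalized Bregman function: $\mathbf\Delta_\psi(\beta,\gamma)=\psi(\beta)-\psi(\gamma)-\delta\psi(\gamma;\beta-\gamma)$; $\bar{\mathbf\Delta}_\psi(\beta,\gamma)=\frac12\{\mathbf\Delta_\psi(\beta,\gamma)+\mathbf\Delta_\psi(\gamma,\beta)\}$; $\mathbf D_2(a,b)=\|a-b\|_2^2/2$. A thresholding function $\Theta(t;\lambda)$ is a real-valued function defined for $t\in\mathbb R$, $0\le\lambda<\infty$ with (i) $\Theta(-t;\lambda)=-\Theta(t;\lambda)$; (ii) $\Theta(t;\lambda)\le\Theta(t';\lambda)$ for $t\le t'$; (iii) $\lim_{t\to\infty}\Theta(t;\lambda)=\infty$; (iv) $0\le\Theta(t;\lambda)\le t$ for $0\le t<\infty$. Put $\Theta^{-1}(u;\lambda)=\sup\{t:\Theta(t;\lambda)\le u\}$ for $u>0$, $P_\Theta(t;\lambda)=\int_0^{|t|}(\Theta^{-1}(u;\lambda)-u)\,du$, and $\mathcal L_\Theta=1-\mathrm{ess\,inf}\{d\Theta^{-1}(u;\lambda)/du:u\ge0\}$. The hard penalty is $P_H(t;\lambda)=(-t^2/2+\lambda|t|)1_{|t|<\lambda}+(\lambda^2/2)1_{|t|\ge\lambda}$.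 For vectors, $P(\beta;\lambda)=\sum_jP(\beta_j;\lambda)$. $J(\beta)=\|\beta\|_0$ is the number of nonzero entries. $a\wedge b=\min(a,b)$; $\|X\|_2$ is the spectral norm. The loss $l_0$ depends on random data, so $\epsilon$ is random; its components need not be independent. The scale of a random variable $\xi$ is $\|\xi\|_{\psi_2}=\inf\{s>0:\mathbb E\exp(\xi^2/s^2)\le2\}$; a random vector $\xi$ is sub-Gaussian with scale bounded by $\sigma$ if $\|\langle\xi,a\rangle\|_{\psi_2}\le\sigma\|a\|_2$ for all vectors $a$. *)

(* Defs.v *)
From HB Require Import structures.
From mathcomp Require Import all_boot all_order all_algebra.
From mathcomp Require Import all_classical all_reals all_analysis.
From mathcomp Require Import ess_sup_inf.

Set Implicit Arguments.
Unset Strict Implicit.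
Unset Printing Implicit Defensive.

Import Order.TTheory GRing.Theory Num.Theory.
Import numFieldNormedType.Exports.

Local Open Scope classical_set_scope.
Local Open Scope ring_scope.

Section Euclidean.
Context {R : realType}.

Definition dotv (n : nat) (u v : 'cV[R]_n) : R := \sum_i u i 0 * v i 0.

(* The library norm `|u| on matrices is the entrywise maximum. *)
Definition norm2 (n : nat) (u : 'cV[R]_n) : R := Num.sqrt (dotv u u).

Definition spectral_norm (n p : nat) (X : 'M[R]_(n, p)) : R :=
  sup [set norm2 (X *m v) | v in [set v : 'cV[R]_p | norm2 v <= 1]].

Definition D2 (n : nat) (a b : 'cV[R]_n) : R := norm2 (a - b) ^+ 2 / 2.

Definition norm0 (p : nat) (b : 'cV[R]_p) : nat := #|[set i | b i 0 != 0]%SET|.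

(* To be used at points of differentiability only. *)
Definition gradient (n : nat) (f : 'cV[R]_n -> R) (x : 'cV[R]_n) : 'cV[R]_n :=
  \col_i 'D_(delta_mx i 0) f x.

End Euclidean.

Section Bregman.
Context {R : realType} {p : nat}.
Implicit Types (psi : 'cV[R]_p -> R) (b h : 'cV[R]_p).

Definition dir_quotient psi b h (e : R) : R := (psi (b + e *: h) - psi b) / e.

Definition dir_derivative psi b h : R :=
  lim (dir_quotient psi b h e @[e --> 0^'+]).

Definition dir_differentiable psi : Prop :=
  forall b h, cvg (dir_quotient psi b h e @[e --> 0^'+]).

Definition gen_bregman psi (b g : 'cV[R]_p) : R :=
  psi b - psi g - dir_derivative psi g (b - g).

Definition sym_bregman psi (b g : 'cV[R]_p) : R :=
  (gen_bregman psi b g + gen_bregman psi g b) / 2.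

Definition argmin (f : 'cV[R]_p -> R) : set 'cV[R]_p :=
  [set b | forall b', f b <= f b'].

End Bregman.

Section Thresholding.
Context {R : realType}.
Implicit Types (Theta : R -> R -> R) (lambda t u : R).

(* The arguments of Theta are t and lambda, in this order. *)
Record thresholding Theta : Prop := Thresholding {
  thr_odd : forall t lambda, 0 <= lambda ->
    Theta (- t) lambda = - Theta t lambda;
  thr_mono : forall t t' lambda, 0 <= lambda -> t <= t' ->
    Theta t lambda <= Theta t' lambda;
  thr_infty : forall lambda, 0 <= lambda ->
    Theta t lambda @[t --> +oo] --> +oo;
  thr_shrink : forall t lambda, 0 <= lambda -> 0 <= t ->
    0 <= Theta t lambda <= t }.

(* Only the values at u > 0 matter below. *)
Definition thr_inv Theta u lambda : R := sup [set t | Theta t lambda <= u].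

Definition P_Theta Theta t lambda : R :=
  Rintegral lebesgue_measure `[0, `|t|] (fun u => thr_inv Theta u lambda - u).

(* [thr_inv Theta ^~ lambda] is nondecreasing and finite on u > 0, hence a.e.
   differentiable there, so that the essential infimum is a finite number. *)
Definition L_Theta Theta lambda : R :=
  1 - fine (ess_inf (mrestr lebesgue_measure (measurable_itv `[0%R, +oo[))
              (fun u : R => (derive1 (thr_inv Theta ^~ lambda) u)%:E)).

Definition P_H t lambda : R :=
  if `|t| < lambda then - t ^+ 2 / 2 + lambda * `|t| else lambda ^+ 2 / 2.

Definition vec_penalty (pen : R -> R -> R) (p : nat) (b : 'cV[R]_p) lambda : R :=
  \sum_j pen (b j 0) lambda.

End Thresholding.

Section SubGaussian.
Context {d : measure_display} {T : measurableType d} {R : realType}.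
Variable P : probability T R.

Definition psi2_norm (xi : T -> R) : \bar R :=
  ereal_inf [set s%:E | s in
    [set s : R | 0 < s /\ ('E_P[fun w => expR (xi w ^+ 2 / s ^+ 2)] <= 2%:E)%E]].

Definition random_vector (n : nat) (xi : T -> 'cV[R]_n) : Prop :=
  forall i, measurable_fun setT (fun w => xi w i 0).

Definition mean_zero (n : nat) (xi : T -> 'cV[R]_n) : Prop :=
  forall i, ('E_P[fun w => xi w i 0%R] = 0)%E.

Definition sub_gaussian (n : nat) (xi : T -> 'cV[R]_n) (sigma : R) : Prop :=
  forall a : 'cV[R]_n,
    (psi2_norm (fun w => dotv (xi w) a) <= (sigma * norm2 a)%:E)%E.

(* The event S need not be measurable; it then has inner probability >= q. *)
Definition with_prob_at_least (q : R) (S : set T) : Prop :=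
  exists E : set T, [/\ measurable E, E `<=` S & (q%:E <= P E)%E].

End SubGaussian.

Section Estimation.
Context {R : realType}.

Definition surrogate (p : nat) (l psi : 'cV[R]_p -> R) (Theta : R -> R -> R)
    (rho lambda : R) (b bminus : 'cV[R]_p) : R :=
  l b + vec_penalty (P_Theta Theta) (rho *: b) lambda + gen_bregman psi b bminus.

Definition log_ep (p : nat) : R := ln (expR 1 * p%:R).

Definition lambda_of (p : nat) (A sigma delta vtheta : R) : R :=
  A * sigma * Num.sqrt (log_ep p) / Num.sqrt (Num.min delta vtheta * vtheta).

End Estimation.

(* Main.v *)
Require Import Defs.
From HB Require Import structures.
From mathcomp Require Import all_boot all_order all_algebra.
From mathcomp Require Import all_classical all_reals all_analysis.
From mathcomp Require Import ess_sup_inf measurable_realfun ring lra.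

Set Implicit Arguments.
Unset Strict Implicit.
Unset Printing Implicit Defensive.

Import Order.TTheory GRing.Theory Num.Theory.
Import numFieldNormedType.Exports.

Local Open Scope classical_set_scope.
Local Open Scope ring_scope.

(* The penalty is semiconvex: [P_Theta t + L_Theta * t ^+ 2 / 2] is convex, since
   its derivative [Theta^-1 u - (1 - L_Theta) * u] is nonnegative and nondecreasing
   for [u >= 0].  Comparing the surrogate at the fixed point [bhat] with its value
   at a point moved infinitesimally towards [bstar] therefore bounds
   [P_Theta (rho * bhat)] by [P_Theta (rho * bstar)], a directional derivative of
   the loss and a term [rho ^+ 2 * L_Theta * D2 bhat bstar]; the Bregman term of
   [psi] is of second order and disappears.  With the assumed inequality at [bhat],
   [delta * D2] plus [vtheta * P_H] is at most the noise term
   [<eps, X (bhat - bstar)>] plus [K * lambda ^+ 2 * J].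

   The noise term is absorbed by half of the left-hand side as soon as the
   projection of [eps] on the span of any [k] columns of [X] has norm
   [O(A * sigma * sqrt (k * log (e p)))].  As the number of supports of size [k] is
   already of the order [p ^ k], one may afford in each such span a grid with
   [(4 p + 1) ^ k] points in an orthonormal basis, and a union bound over all
   supports and grid points suffices. *)

(** * Euclidean inner product, spectral bound and orthonormalization *)

Section EuclideanGeometry.
Context {R : realType}.
Implicit Types n p : nat.

Lemma dotvC n (u v : 'cV[R]_n) : dotv u v = dotv v u.
Proof. by apply: eq_bigr => i _; rewrite mulrC. Qed.

Lemma dotvDl n (u v w : 'cV[R]_n) : dotv (u + v) w = dotv u w + dotv v w.
Proof. by rewrite -big_split; apply: eq_bigr => i _; rewrite mxE mulrDl. Qed.

Lemma dotvZl n a (u w : 'cV[R]_n) : dotv (a *: u) w = a * dotv u w.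
Proof. by rewrite [RHS]mulr_sumr; apply: eq_bigr => i _; rewrite mxE mulrA. Qed.

Lemma dotvDr n (u v w : 'cV[R]_n) : dotv w (u + v) = dotv w u + dotv w v.
Proof. by rewrite dotvC dotvDl !(dotvC w). Qed.

Lemma dotvZr n a (u w : 'cV[R]_n) : dotv w (a *: u) = a * dotv w u.
Proof. by rewrite dotvC dotvZl (dotvC w). Qed.

Lemma dotvNr n (u w : 'cV[R]_n) : dotv w (- u) = - dotv w u.
Proof. by rewrite -scaleN1r dotvZr mulN1r. Qed.

Lemma dotvNl n (u w : 'cV[R]_n) : dotv (- u) w = - dotv u w.
Proof. by rewrite dotvC dotvNr dotvC. Qed.

Lemma dotv0r n (w : 'cV[R]_n) : dotv w 0 = 0.
Proof. by rewrite -(scale0r 0) dotvZr mul0r. Qed.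

Lemma dotv_sumr n (I : Type) (r : seq I) (Q : pred I) (F : I -> 'cV[R]_n) w :
  dotv w (\sum_(i <- r | Q i) F i) = \sum_(i <- r | Q i) dotv w (F i).
Proof.
by apply: (big_morph (dotv w)) => [u v|]; [exact: dotvDr|exact: dotv0r].
Qed.

Lemma dotvv_ge0 n (u : 'cV[R]_n) : 0 <= dotv u u.
Proof. by apply: sumr_ge0 => i _; rewrite -expr2 sqr_ge0. Qed.

Lemma dotvv_eq0 n (u : 'cV[R]_n) : dotv u u = 0 -> u = 0.
Proof.
move=> u0; apply/colP => i; rewrite mxE.
have/eqP := u0; rewrite psumr_eq0 => [/allP/(_ i (mem_index_enum _))|j _].
  by rewrite /= -expr2 sqrf_eq0 => /eqP.
by rewrite -expr2 sqr_ge0.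
Qed.

Lemma norm2_ge0 n (u : 'cV[R]_n) : 0 <= norm2 u.
Proof. exact: sqrtr_ge0. Qed.

Lemma sqr_norm2 n (u : 'cV[R]_n) : norm2 u ^+ 2 = dotv u u.
Proof. by rewrite sqr_sqrtr ?dotvv_ge0. Qed.

Lemma norm2_eq0 n (u : 'cV[R]_n) : norm2 u = 0 -> u = 0.
Proof. by move=> u0; apply: dotvv_eq0; rewrite -sqr_norm2 u0 expr0n. Qed.

Lemma norm2Z n a (u : 'cV[R]_n) : norm2 (a *: u) = `|a| * norm2 u.
Proof. by rewrite /norm2 dotvZl dotvZr mulrA -expr2 sqrtrM ?sqr_ge0// sqrtr_sqr. Qed.

Lemma norm2N n (u : 'cV[R]_n) : norm2 (- u) = norm2 u.
Proof. by rewrite -scaleN1r norm2Z normrN1 mul1r. Qed.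

Lemma dotv_le_norm2 n (u v : 'cV[R]_n) : dotv u v <= norm2 u * norm2 v.
Proof.
have [/eqP u0|u0] := boolP (norm2 u == 0).
  by rewrite u0 mul0r (norm2_eq0 u0) dotvC dotv0r.
have [/eqP v0|v0] := boolP (norm2 v == 0).
  by rewrite v0 mulr0 (norm2_eq0 v0) dotv0r.
have a0 : 0 < norm2 u by rewrite lt_def u0 norm2_ge0.
have b0 : 0 < norm2 v by rewrite lt_def v0 norm2_ge0.
(* Expanded, this square equals [2 * (a * b) * (a * b - x)]. *)
have := dotvv_ge0 (norm2 v *: u + - (norm2 u *: v)).
rewrite !(dotvDl, dotvDr, dotvNl, dotvNr, dotvZl, dotvZr) (dotvC v u).
rewrite -!sqr_norm2; set a := norm2 u; set b := norm2 v; set x := dotv u v.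
move=> h; have : 0 <= 2 * (a * b) * (a * b - x) by lra.
by rewrite pmulr_rge0 ?subr_ge0// !mulr_gt0.
Qed.

Lemma ler_norm2D n (u v : 'cV[R]_n) : norm2 (u + v) <= norm2 u + norm2 v.
Proof.
rewrite -(@ler_pXn2r _ 2)// ?nnegrE ?addr_ge0 ?norm2_ge0//.
rewrite sqrrD !sqr_norm2 !(dotvDl, dotvDr) (dotvC v u).
have := dotv_le_norm2 u v; lra.
Qed.

Lemma dotv_delta n (u : 'cV[R]_n) i : dotv u (delta_mx i 0) = u i 0.
Proof.
rewrite /dotv (bigD1 i)//= mxE !eqxx mulr1 big1 ?addr0// => j ji.
by rewrite mxE (negbTE ji) mulr0.
Qed.

Lemma norm2_delta n (i : 'I_n) : norm2 (delta_mx i 0 : 'cV[R]_n) = 1.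
Proof. by rewrite /norm2 dotv_delta mxE !eqxx sqrtr1. Qed.

Lemma ler_entry_norm2 n (u : 'cV[R]_n) i : `|u i 0| <= norm2 u.
Proof.
rewrite -sqrtr_sqr ler_wsqrtr// /dotv (bigD1 i)//= -expr2 lerDl sumr_ge0//.
by move=> j _; rewrite -expr2 sqr_ge0.
Qed.

Lemma norm2_sum n (I : Type) (r : seq I) (Q : pred I) (F : I -> 'cV[R]_n) :
  norm2 (\sum_(i <- r | Q i) F i) <= \sum_(i <- r | Q i) norm2 (F i).
Proof.
elim/big_ind2 : _ => [|u x v y ux vy|//]; first by rewrite /norm2 dotv0r sqrtr0.
by rewrite (le_trans (ler_norm2D _ _))// lerD.
Qed.

Lemma mulmx_cols n p (X : 'M[R]_(n, p)) (v : 'cV[R]_p) :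
  X *m v = \sum_j v j 0 *: col j X.
Proof.
apply/colP => i; rewrite mxE summxE; apply: eq_bigr => j _.
by rewrite !mxE mulrC.
Qed.

Lemma norm2_mulmx_le n p (X : 'M[R]_(n, p)) rho (v : 'cV[R]_p) :
  spectral_norm X <= rho -> norm2 (X *m v) <= rho * norm2 v.
Proof.
move=> Xrho; have [/eqP v0|v0] := boolP (norm2 v == 0).
  by rewrite v0 mulr0 (norm2_eq0 v0) mulmx0 /norm2 dotv0r sqrtr0.
have vp : 0 < norm2 v by rewrite lt_def v0 norm2_ge0.
set B := [set norm2 (X *m v) | v in [set v : 'cV[R]_p | norm2 v <= 1]].
(* On the unit ball all entries are at most 1 in absolute value, so the column norms add up to an
   upper bound and the supremum is a genuine one. *)
have hB : has_sup B.
  split; first by exists (norm2 (X *m 0)), 0 => //=; rewrite /norm2 dotv0r sqrtr0.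
  exists (\sum_j norm2 (col j X)) => _ [u /= u1 <-].
  rewrite mulmx_cols (le_trans (norm2_sum _ _ _))// ler_sum// => j _.
  by rewrite norm2Z ler_piMl ?norm2_ge0// (le_trans (ler_entry_norm2 _ _)).
rewrite mulrC -ler_pdivrMl//.
have -> : (norm2 v)^-1 * norm2 (X *m v) = norm2 (X *m ((norm2 v)^-1 *: v)).
  by rewrite -scalemxAr norm2Z gtr0_norm ?invr_gt0.
apply: le_trans Xrho; apply: sup_ubound; first exact: hB.2.
by exists ((norm2 v)^-1 *: v) => //=; rewrite norm2Z gtr0_norm ?invr_gt0// mulVf.
Qed.

(* Linearly dependent vectors yield zero vectors in the output, so that the
   result is indexed like the input. *)
Lemma gram_schmidt n (x : nat -> 'cV[R]_n) m : exists e : nat -> 'cV[R]_n,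
  [/\ forall i j, i != j -> dotv (e i) (e j) = 0,
      forall i, dotv (e i) (e i) <= 1,
      forall j, x j = 0 -> e j = 0 &
      forall j, (j < m)%N -> x j = \sum_(i < m) dotv (x j) (e i) *: e i].
Proof.
(* The induction carries more: squared norms are exactly 0 or 1, so that subtracting projections
   leaves a residual orthogonal to every [e i], and [e j] vanishes from [m] on, so that position [m]
   is free. *)
suff [e [e1 e2 e3 e4 _]] : exists e : nat -> 'cV[R]_n,
  [/\ forall i j, i != j -> dotv (e i) (e j) = 0,
      forall i, dotv (e i) (e i) = (e i != 0)%:R,
      forall j, x j = 0 -> e j = 0,
      forall j, (j < m)%N -> x j = \sum_(i < m) dotv (x j) (e i) *: e i &
      forall j, (m <= j)%N -> e j = 0].
  by exists e; split => // i; rewrite e2; case: eqP => //; rewrite ler01.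
elim: m => [|m [e [e1 e2 e3 e4 e5]]].
  exists (fun=> 0); split => // [i j _|i]; first by rewrite dotv0r.
  by rewrite dotv0r eqxx.
pose r := x m - \sum_(i < m) dotv (x m) (e i) *: e i.
have re i : dotv r (e i) = 0.
  have [im|mi] := ltnP i m; last by rewrite (e5 i mi) dotv0r.
  rewrite dotvC dotvDr dotvNr dotv_sumr (bigD1 (Ordinal im))//=.
  rewrite big1 => [|j ji]; last first.
    by rewrite dotvZr e1 ?mulr0// eq_sym.
  rewrite addr0 dotvZr e2 (dotvC (e i)).
  by have [->|_] := eqVneq (e i) 0; rewrite ?dotv0r ?mulr1 ?mul0r subrr.
pose f := (norm2 r)^-1 *: r.
have ff : dotv f f = (f != 0)%:R.
  have [->|f0] := eqVneq f 0; first by rewrite dotv0r.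
  have r0 : norm2 r != 0.
    by apply: contra f0 => /eqP r0; rewrite /f r0 invr0 scale0r.
  by rewrite dotvZl dotvZr -sqr_norm2 /=; field.
have fe i : dotv f (e i) = 0 by rewrite dotvZl re mulr0.
have xmE : x m = \sum_(i < m) dotv (x m) (e i) *: e i + dotv (x m) f *: f.
  suff -> : dotv (x m) f *: f = r by rewrite addrC subrK.
  have -> : dotv (x m) f = dotv r f.
    rewrite /r dotvDl dotvNl [X in _ - X]dotvC dotv_sumr big1 ?subr0// => i _.
    by rewrite dotvZr fe mulr0.
  have [r0|r0] := eqVneq r 0; first by rewrite /f r0 !scaler0.
  have nr0 : norm2 r != 0 by apply: contra r0 => /eqP/norm2_eq0 ->.
  rewrite /f dotvZr -sqr_norm2 scalerA.
  by rewrite [X in X *: _](_ : _ = 1) ?scale1r//; field.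
exists (fun i => if i == m then f else e i); split.
- move=> i j ij; have [im|im] := eqVneq i m; have [jm|jm] := eqVneq j m => //.
  + by rewrite im jm eqxx in ij.
  + by rewrite dotvC fe.
  + exact: e1.
- by move=> i; case: ifP => _; [exact: ff|exact: e2].
- move=> j xj0; have [jm|_] := eqVneq j m; last exact: e3.
  rewrite /f /r -jm xj0 sub0r big1 => [|i _]; first by rewrite oppr0 scaler0.
  by rewrite dotvC dotv0r scale0r.
- move=> j; rewrite ltnS leq_eqVlt big_ord_recr/= eqxx => jm.
  have -> : \sum_(i < m) dotv (x j) (if i == m :> nat then f else e i)
      *: (if i == m :> nat then f else e i) = \sum_(i < m) dotv (x j) (e i) *: e i.
    by apply: eq_bigr => i _; rewrite ltn_eqF.
  case/orP : jm => [/eqP ->//|jm].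
  have -> : dotv (x j) f = 0.
    rewrite (e4 j jm) dotvC dotv_sumr big1// => i _.
    by rewrite dotvZr fe mulr0.
  by rewrite scale0r addr0; exact: e4.
- move=> j mj; rewrite gtn_eqF//; exact/e5/ltnW.
Qed.

End EuclideanGeometry.

(** * Growth of monotone functions from an almost everywhere bound on the derivative *)

Section MonotoneSlope.
Context {R : realType}.
Notation mu := (@lebesgue_measure R).

Lemma lebesgue_measure_mono (A B : set R) :
  measurable A -> measurable B -> A `<=` B -> (mu A <= mu B)%E.
Proof. by move=> mA mB; exact: (le_measure mu (mem_set mA) (mem_set mB)). Qed.

Lemma cvg_dnbhs_at_right (T : topologicalType) (f : R -> T) (x : R) (F : set_system T) :
  f @ x^' --> F -> f @ x^'+ --> F.
Proof.
apply: cvg_trans => A [e e0 eA]; exists e => // y ye xy.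
by apply: eA => //=; rewrite gt_eqF.
Qed.

Lemma derive1_gt0_slope (f : R -> R) (x k : R) : 0 < f^`()%classic x -> k < f^`()%classic x ->
  \forall h \near 0^'+, k * h <= f (x + h) - f x.
Proof.
move=> f'0 kf'.
(* Where the difference quotient diverges, [derive1] takes the default value 0; a positive value
   therefore certifies convergence. *)
have cf : cvg ((fun h => h^-1 *: (f (h + x) - f x)) @ 0^').
  apply: contrapT => /dvgP f'E; move: f'0.
  by rewrite /derive1 f'E (_ : point = 0 :> R)// ltxx.
have cr : (fun h => h^-1 *: (f (h + x) - f x)) h @[h --> 0^'+] --> f^`()%classic x.
  exact: cvg_dnbhs_at_right.
near=> h.
have h0 : 0 < h by near: h; exact: nbhs_right_gt.
rewrite -ler_pdivlMr// mulrC (addrC x); apply/ltW.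
by near: h; exact: (cvgr_gt _ cr).
Unshelve. all: by end_near. Qed.

(* No continuity of [f] is needed: since [f] can only jump upwards, the last
   point up to which the bound holds cannot be before [b].  On the exceptional
   null set, covered by a small open [U], the growth of the measure of [U]
   replaces that of [f]. *)
Lemma monotone_slope_cover (f : R -> R) (m k a b : R) (U : set R) :
  {homo f : x y / x <= y} -> 0 < k -> k < m -> a <= b -> open U ->
  (mu U < +oo)%E ->
  (forall x, a <= x <= b -> ~ U x -> m <= f^`()%classic x) ->
  k * (b - a) <= f b - f a + m * fine (mu U).
Proof.
move=> fnd k0 km ab oU Uoo fm.
have m0 : 0 < m by exact: lt_trans km.
have mU : measurable U by exact: open_measurable.
pose I x := U `&` `[a, x].
have mI x : measurable (I x) by exact: measurableI.
have muI x : (mu (I x) <= mu U)%E by apply: lebesgue_measure_mono => //; exact: subIsetl.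
have fI x : mu (I x) \is a fin_num.
  by rewrite ge0_fin_numE// (le_lt_trans (muI x)).
pose G x := fine (mu (I x)).
have Gnd x y : x <= y -> G x <= G y.
  move=> xy; apply: fine_le => //; apply: lebesgue_measure_mono => //.
  by apply: setIS; apply: subset_itvl; rewrite bnd_simp.
have Gadd x y : a <= x -> x <= y -> `]x, y] `<=` U -> G x + (y - x) <= G y.
  move=> ax xy xyU; rewrite -lee_fin EFinD !fineK//.
  have -> : ((y - x)%:E = mu `]x, y])%E.
    by rewrite lebesgue_measure_itv/= lte_fin; case: ltgtP xy => // -> _; rewrite subrr.
  rewrite -(measureU mu (mI x))//; last first.
    apply/seteqP; split => // z [[_ /=]]; rewrite !in_itv/= => /andP[_ zx] /andP[xz _].
    by move: (lt_le_trans xz zx); rewrite ltxx.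
  apply: lebesgue_measure_mono => //; first exact: measurableU.
  move=> z [[Uz /=]|zxy].
    rewrite in_itv/= => /andP[az zx]; split => //=.
    by rewrite in_itv/= az (le_trans zx).
  split; first exact: xyU.
  move: zxy; rewrite /= !in_itv/= => /andP[xz ->]; rewrite andbT.
  exact: le_trans ax (ltW xz).
pose E := [set x | a <= x <= b /\ k * (x - a) <= f x - f a + m * G x].
have Ea : E a.
  split; first by rewrite lexx ab.
  by rewrite !subrr mulr0 add0r mulr_ge0 ?fine_ge0// ltW.
have sE : has_sup E by split; [exists a|exists b => x [/andP[]]].
pose s := sup E.
have as_ : a <= s by exact: sup_upper_bound.
have sb : s <= b by apply: ge_sup; [exists a|move=> x [/andP[]]].
(* [E] contains its supremum even if [f] jumps there: [f] and [G] are no larger at points of [E]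
   than at [s]. *)
have Es : E s.
  split; first by rewrite as_ sb.
  rewrite -ler_pdivlMl// lerBlDr; apply: ge_sup; first by exists a.
  move=> x Ex; rewrite -lerBlDr ler_pdivlMl//.
  have xs : x <= s by exact: sup_upper_bound.
  apply: le_trans Ex.2 _; rewrite lerD ?lerD2r ?fnd// ler_pM2l//.
  exact: Gnd.
have step h : 0 < h -> s + h <= b ->
    k * h <= f (s + h) - f s + m * (G (s + h) - G s) -> False.
  move=> h0 shb H; have : E (s + h).
    split; first by rewrite shb andbT (le_trans as_)// lerDl ltW.
    have := Es.2; lra.
  by move=> /(sup_upper_bound sE); rewrite -/s gerDl leNgt h0.
have [bs|sb'] := leP b s.
  have -> : b = s by apply/eqP; rewrite eq_le bs sb.
  apply: le_trans Es.2 _; rewrite lerD2l ler_pM2l// fine_le//.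
  by rewrite ge0_fin_numE.
(* Inside [U], [m * G] grows at rate [m > k] just after [s]; outside [U], the derivative of [f] at
   [s] exceeds [k]. Either way [E] would extend beyond [s]. *)
exfalso; have [Us|Us] := pselect (U s).
  have [e /= e0 eU] : \forall e \near 0^'+, `]s, s + e] `<=` U.
    have /nbhs_ballP[e /= e0 eU] : nbhs s U by exact: open_nbhs_nbhs.
    exists e => //= h; rewrite /ball/= sub0r normrN => he h0 z.
    rewrite /= in_itv/= => /andP[sz zh]; apply: eU.
    rewrite /ball/= ltr_distlC; rewrite gtr0_norm// in he; lra.
  pose h := Num.min (e / 2) (b - s).
  have h0 : 0 < h by rewrite lt_min divr_gt0//= subr_gt0.
  have he : h < e by rewrite (@le_lt_trans _ _ (e / 2)) ?ge_min ?lexx//; lra.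
  have hb : h <= b - s by rewrite ge_min lexx orbT.
  apply: (step h) => //; first lra.
  have hU : `]s, s + h] `<=` U by apply: eU => //=; rewrite sub0r normrN gtr0_norm.
  have GG : G s + (s + h - s) <= G (s + h) by apply: Gadd => //; lra.
  have /fnd ff : s <= s + h by lra.
  have : k * h <= m * h by rewrite ler_pM2r// ltW.
  have : m * h <= m * (G (s + h) - G s) by rewrite ler_pM2l//; lra.
  lra.
have fs : m <= f^`()%classic s by apply: fm => //; rewrite as_ sb.
have [e /= e0 ef] := derive1_gt0_slope (lt_le_trans m0 fs) (lt_le_trans km fs).
pose h := Num.min (e / 2) (b - s).
have h0 : 0 < h by rewrite lt_min divr_gt0//= subr_gt0.
have he : h < e by rewrite (@le_lt_trans _ _ (e / 2)) ?ge_min ?lexx//; lra.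
have hb : h <= b - s by rewrite ge_min lexx orbT.
apply: (step h) => //; first lra.
have : k * h <= f (s + h) - f s by apply: ef => //=; rewrite sub0r normrN gtr0_norm.
have : 0 <= m * (G (s + h) - G s) by rewrite pmulr_rge0// subr_ge0 Gnd//; lra.
lra.
Qed.

(** Outer regularity covers the exceptional null set by an open set so small that its contribution
    in [monotone_slope_cover] is at most [e / 2]; replacing [m] by a slightly smaller [k] costs the
    other [e / 2]. *)
Lemma monotone_slope (f : R -> R) (m a b : R) (D : set R) (mD : measurable D) :
  {homo f : x y / x <= y} -> a <= b -> `[a, b] `<=` D ->
  (\forall x \ae mrestr mu mD, m <= f^`()%classic x) ->
  m * (b - a) <= f b - f a.
Proof.
move=> fnd ab abD [B [mB B0 BD]].
have [m0|m0] := leP m 0.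
  by rewrite (@le_trans _ _ 0) ?subr_ge0 ?fnd// mulr_le0_ge0// subr_ge0.
have {}B0 : mu (B `&` D) = 0%E := B0.
have mBD : measurable (B `&` D) by exact: measurableI.
apply/ler_addgt0Pr => e e0.
pose e1 := e / 2 / m.
have e10 : 0 < e1 by rewrite !divr_gt0.
have muBD : (mu (B `&` D) < +oo)%E by rewrite B0.
have [U [oU BU Ue]] := lebesgue_regularity_outer mBD muBD e10.
have mU : measurable U by exact: open_measurable.
have muU : (mu U < e1%:E)%E.
  apply: le_lt_trans Ue; rewrite -[leRHS]adde0 -B0.
  rewrite -(measureU mu)//; last 2 first.
  - exact: measurableD.
  - by apply/seteqP; split => // x [[_ nBD]].
  by rewrite setUC setDUK.
have fU : mu U \is a fin_num by rewrite ge0_fin_numE// (lt_trans muU) ?ltry.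
have muU' : fine (mu U) < e1 by rewrite -lte_fin fineK.
(* The first argument keeps [k] positive, the second keeps the loss over [[a, b]] below [e / 2]; the
   [+ 1] avoids dividing by zero when [a = b]. *)
pose k := Num.max (m / 2) (m - e / 2 / (b - a + 1)).
have ba : 0 < b - a + 1 by lra.
have q0 : 0 < e / 2 / (b - a + 1) by rewrite !divr_gt0.
have := @monotone_slope_cover f m k a b U fnd _ _ ab oU _ _.
rewrite lt_max divr_gt0//= => /(_ isT).
rewrite gt_max.
have -> : (m / 2 < m) && (m - e / 2 / (b - a + 1) < m) by apply/andP; split; lra.
move=> /(_ isT (lt_trans muU (ltry _))) H.
have {}H : k * (b - a) <= f b - f a + m * fine (mu U).
  apply: H => x xab nUx; apply: contrapT => nx; apply: nUx; apply: BU; split.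
    exact: BD.
  by apply: abD.
have kE : m - e / 2 / (b - a + 1) <= k by rewrite le_max lexx orbT.
have : (m - e / 2 / (b - a + 1)) * (b - a) <= k * (b - a).
  by rewrite ler_wpM2r// subr_ge0.
have : e / 2 / (b - a + 1) * (b - a + 1) = e / 2 by field; lra.
have : m * fine (mu U) <= m * e1 by rewrite ler_pM2l// ltW.
have : m * e1 = e / 2 by rewrite /e1; field; lra.
lra.
Qed.

End MonotoneSlope.

(** * Semiconvexity of the penalty attached to a thresholding rule *)

Section ThresholdingPenalty.
Context {R : realType}.
Notation mu := (@lebesgue_measure R).
Variables (Theta : R -> R -> R) (lambda : R).
Hypotheses (hT : thresholding Theta) (l0 : 0 <= lambda).

(** Divergence of [Theta] at infinity bounds the set from above and, through oddness, makes it
    nonempty, also for negative [u]. Hence [thr_inv] is monotone on the whole line. *)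
Lemma has_sup_thr_inv u : has_sup [set t | Theta t lambda <= u].
Proof.
have Tu (c : R) : exists M, forall t, M < t -> c < Theta t lambda.
  have /cvgryPgt/(_ c) [M [_ MT]] := thr_infty hT l0.
  by exists M.
split.
  have [M MT] := Tu (- u); exists (- (M + 1)) => /=.
  by rewrite thr_odd// lerNl ltW// MT// ltrDl.
have [M MT] := Tu u; exists M => t /=; rewrite leNgt => tu.
by rewrite leNgt; apply: contra tu => /MT.
Qed.

Lemma thr_inv_nd : {homo thr_inv Theta ^~ lambda : u v / u <= v}.
Proof.
move=> u v uv; apply: ge_sup; first exact: (has_sup_thr_inv u).1.
move=> t /= tu; apply: sup_upper_bound; first exact: has_sup_thr_inv.
exact: le_trans uv.
Qed.

Lemma thr_inv_ge u : 0 <= u -> u <= thr_inv Theta u lambda.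
Proof.
move=> u0; apply: sup_upper_bound; first exact: has_sup_thr_inv.
by have /andP[] := thr_shrink hT l0 u0.
Qed.

Lemma thr_inv_slope u v : 0 <= u -> u <= v ->
  (1 - L_Theta Theta lambda) * (v - u)
    <= thr_inv Theta v lambda - thr_inv Theta u lambda.
Proof.
move=> u0 uv; rewrite /L_Theta opprB addrC subrK.
set mr := mrestr _ _; set f := thr_inv Theta ^~ lambda.
have fnd : {homo f : x y / x <= y} := thr_inv_nd.
have := ess_inf_le mr (fun u => (f^`()%classic u)%:E).
case: ess_inf => [m|_|_] /=; last 2 first.
(* [fine] sends an infinite essential infimum to 0, and then monotonicity is enough. *)
- by rewrite mul0r subr_ge0 fnd.
- by rewrite mul0r subr_ge0 fnd.
move=> fm; apply: (monotone_slope fnd uv) fm.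
by move=> x /=; rewrite !in_itv/= andbT => /andP[ux _]; exact: le_trans ux.
Qed.

Lemma integrable_affine (c0 c1 b : R) : 0 <= b ->
  mu.-integrable `[0, b] (EFin \o (fun u => c0 + c1 * u)) /\
  Rintegral mu `[0, b] (fun u => c0 + c1 * u) = c0 * b + c1 * b ^+ 2 / 2.
Proof.
move=> b0.
have cf : continuous (fun u : R => c0 + c1 * u).
  by move=> x; apply: cvgD; [exact: cvg_cst|apply: cvgM; [exact: cvg_cst|exact: cvg_id]].
split.
  apply: continuous_compact_integrable; first exact: segment_compact.
  exact: continuous_subspaceT.
move: b0; rewrite le_eqVlt => /predU1P[<-|b0].
  by rewrite set_itv1 Rintegral_set1 expr2 !mulr0 mul0r addr0.
pose F (u : R) := c0 * u + c1 / 2 * u ^+ 2.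
have dF (x : R) : is_derive x (1 : R) F (c0 + c1 * x).
  rewrite /F; apply: is_derive_eq.
  by rewrite /GRing.scale/=; field.
rewrite /Rintegral (@continuous_FTC2 _ _ F)//=.
- by rewrite /F; field.
- exact: continuous_subspaceT.
- have cF : continuous F.
    by move=> x; apply: differentiable_continuous; apply/derivable1_diffP.
  by split => //; [apply: cvg_at_right_filter|apply: cvg_at_left_filter]; exact: cF.
- by move=> x _; rewrite derive1E derive_val.
Qed.

Lemma integrable_thr_gap b :
  mu.-integrable `[0, b] (EFin \o (fun u => thr_inv Theta u lambda - u)).
Proof.
apply: measurable_bounded_integrable => //.
- by rewrite /= lebesgue_measure_itv/=; case: ifP => _; rewrite -?EFinB ltry.
- apply: measurable_funB => //.
  by apply: nondecreasing_measurable => // x y xy; exact: thr_inv_nd.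
- exists (thr_inv Theta b lambda); split; first exact: num_real.
  move=> M bM x /=; rewrite in_itv/= => /andP[x0 xb].
  rewrite ger0_norm ?subr_ge0 ?thr_inv_ge// (le_trans _ (ltW bM))//.
  by rewrite lerBlDr (le_trans (thr_inv_nd xb))// lerDl.
Qed.

(** As a function of its upper endpoint, the integral decreases up to [a] and increases
    afterwards. *)
Lemma Rintegral0_mono (g : R -> R) (a b : R) : 0 <= a -> 0 <= b ->
  mu.-integrable `[0, Num.max a b] (EFin \o g) ->
  (forall u, a <= u -> 0 <= g u) -> (forall u, 0 <= u <= a -> g u <= 0) ->
  Rintegral mu `[0, a] g <= Rintegral mu `[0, b] g.
Proof.
move=> a0 b0 ig gp gn; rewrite -subr_ge0; have [ab|ba] := leP a b.
  rewrite max_r// in ig.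
  rewrite (Rintegral_itvB ig) ?bnd_simp//; apply: Rintegral_ge0 => u /=.
  by rewrite in_itv/= => /andP[au _]; apply/gp/ltW.
rewrite max_l ?ltW// in ig.
rewrite -opprB oppr_ge0 (Rintegral_itvB ig) ?bnd_simp//; last exact: ltW.
have -> : 0 = Rintegral mu `]b, a] (fun=> 0) by rewrite Rintegral_cst// mul0r.
apply: le_Rintegral => //.
- apply: integrableS ig => //; apply: subset_itvr; rewrite bnd_simp//.
- exact: integrable0.
- move=> u /=; rewrite in_itv/= => /andP[bu ua]; apply: gn.
  by rewrite ua andbT (le_trans b0)// ltW.
Qed.

(** The affine function [h] of slope [- L] agrees with the integrand [w] at [a], and [w - h] is
    nondecreasing by [thr_inv_slope]. So it changes sign at [a], where its integral is minimal. *)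
Lemma P_Theta_lb (a b : R) : 0 <= a -> 0 <= b ->
  P_Theta Theta a lambda + (thr_inv Theta a lambda - a) * (b - a)
    - L_Theta Theta lambda * (b - a) ^+ 2 / 2 <= P_Theta Theta b lambda.
Proof.
move=> a0 b0; rewrite /P_Theta !ger0_norm//.
set L := L_Theta _ _; pose w (u : R) := thr_inv Theta u lambda - u.
rewrite -/(w a) -/w.
pose c0 := w a + L * a.
pose h u := c0 + - L * u.
have iw b : mu.-integrable `[0, b] (EFin \o w) := integrable_thr_gap b.
have aff b' : 0 <= b' -> _ := @integrable_affine c0 (- L) b'.
have iwh b' : 0 <= b' -> Rintegral mu `[0, b'] (fun u => w u - h u) =
    Rintegral mu `[0, b'] w - (c0 * b' - L * b' ^+ 2 / 2).
  by move=> b'0; have [ih hE] := aff _ b'0; rewrite RintegralB// hE !mulNr.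
suff : Rintegral mu `[0, a] (fun u => w u - h u) <= Rintegral mu `[0, b] (fun u => w u - h u).
  by rewrite !iwh// /c0 -/(w a); lra.
apply: Rintegral0_mono => //.
- rewrite (_ : _ \o _ = (EFin \o w) \- (EFin \o h))%E//.
  apply: integrableB => //.
  by apply: (aff _ _).1; rewrite le_max a0.
- move=> u au; have := thr_inv_slope a0 au; rewrite -/L /h /c0 /w; lra.
- move=> u /andP[u0 ua]; have := thr_inv_slope u0 ua; rewrite -/L /h /c0 /w; lra.
Qed.

(** On nonnegative points this is [P_Theta_lb], with slope [h]. Evenness extends it to all signs,
    because the sign of [a] times [b] is at most the absolute value of [b] and [h] is
    nonnegative. *)
Lemma P_Theta_subgradient a : exists g, forall b,
  P_Theta Theta a lambda + L_Theta Theta lambda * a ^+ 2 / 2 + g * (b - a)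
    <= P_Theta Theta b lambda + L_Theta Theta lambda * b ^+ 2 / 2.
Proof.
have P_norm c : P_Theta Theta `|c| lambda = P_Theta Theta c lambda.
  by rewrite /P_Theta normr_id.
have a0 := normr_ge0 a; set L := L_Theta _ _.
pose h := thr_inv Theta `|a| lambda - (1 - L) * `|a|.
have h0 : 0 <= h.
  by have := thr_inv_slope (lexx 0) a0; have := thr_inv_ge (lexx 0); rewrite /h -/L; lra.
exists (h * Num.sg a) => b.
have := P_Theta_lb a0 (normr_ge0 b); rewrite !P_norm -/L => H.
have ea : `|a| ^+ 2 = a ^+ 2 by rewrite real_normK ?num_real.
have eb : `|b| ^+ 2 = b ^+ 2 by rewrite real_normK ?num_real.
have sa : Num.sg a * a = `|a| by rewrite -normrEsg.
have sb : Num.sg a * b <= `|b|.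
  rewrite (le_trans (ler_norm _))// normrM ler_piMl// normr_sg.
  by case: (a == 0).
have : h * (Num.sg a * b) <= h * `|b| by rewrite ler_wpM2l.
have : h * (Num.sg a * a) = h * `|a| by rewrite sa.
rewrite -ea -eb /h; lra.
Qed.

(** Averaging the subgradient inequality at the intermediate point over [a] and [b] cancels [g]; the
    squares leave exactly the last term. *)
Lemma P_Theta_semiconvex a b s : 0 <= s <= 1 ->
  P_Theta Theta (a + s * (b - a)) lambda
    <= (1 - s) * P_Theta Theta a lambda + s * P_Theta Theta b lambda
       + s * (1 - s) * (L_Theta Theta lambda * (b - a) ^+ 2 / 2).
Proof.
move=> /andP[s0 s1]; set L := L_Theta _ _; set c := a + _.
have [g gP] := P_Theta_subgradient c; rewrite -/L in gP.
have ga : (1 - s) * (P_Theta Theta c lambda + L * c ^+ 2 / 2 + g * (a - c))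
    <= (1 - s) * (P_Theta Theta a lambda + L * a ^+ 2 / 2).
  by rewrite ler_wpM2l// subr_ge0.
have gb : s * (P_Theta Theta c lambda + L * c ^+ 2 / 2 + g * (b - c))
    <= s * (P_Theta Theta b lambda + L * b ^+ 2 / 2).
  by rewrite ler_wpM2l.
have := lerD ga gb; set Pc := P_Theta _ c _; rewrite /c; lra.
Qed.

End ThresholdingPenalty.

(** * One-sided directional derivatives and Bregman functions *)

Section DirectionalDerivative.
Context {R : realType}.

Lemma scale_at_right (s : R) : 0 < s -> s * e @[e --> 0^'+] --> 0^'+.
Proof.
move=> s0 A [e /= e0 eA]; exists (e / s); first exact: divr_gt0.
move=> y /=; rewrite !sub0r !normrN => ye y0.
apply: eA => /=; last exact: mulr_gt0.
by rewrite sub0r normrN normrM gtr0_norm// mulrC -ltr_pdivlMr.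
Qed.

Lemma dir_derivativeZ p (f : 'cV[R]_p -> R) b h s : dir_differentiable f -> 0 < s ->
  dir_derivative f b (s *: h) = s * dir_derivative f b h.
Proof.
move=> df s0; apply/cvg_lim => //.
have -> : dir_quotient f b (s *: h) = (fun e => s * dir_quotient f b h (s * e)).
  apply/funext => e; rewrite /dir_quotient scalerA mulrC (mulrC s e).
  have [->|e0] := eqVneq e 0; first by rewrite !(mul0r, mulr0, invr0).
  by field; rewrite e0 gt_eqF.
apply: cvgM; first exact: cvg_cst.
exact: (cvg_comp _ _ (scale_at_right s0) (df b h)).
Qed.

Lemma gen_bregman_diag p (f : 'cV[R]_p -> R) b : gen_bregman f b b = 0.
Proof.
rewrite /gen_bregman !subrr sub0r; apply/eqP; rewrite oppr_eq0; apply/eqP.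
apply/cvg_lim => //.
rewrite (_ : dir_quotient _ _ _ = fun=> 0); first exact: cvg_cst.
by apply/funext => e; rewrite /dir_quotient scaler0 addr0 subrr mul0r.
Qed.

(** The bracket tends to 0 with [s], which exhibits the Bregman term as negligible to first
    order. *)
Lemma gen_bregman_step p (f : 'cV[R]_p -> R) b h s : dir_differentiable f -> 0 < s ->
  gen_bregman f (b + s *: h) b = s * (dir_quotient f b h s - dir_derivative f b h).
Proof.
move=> df s0; rewrite /gen_bregman [b + _]addrC addrK dir_derivativeZ//.
by rewrite /dir_quotient addrC; field; rewrite gt_eqF.
Qed.

(** Differentiability at the point turns the one-sided limit into the linear differential, which is
    expanded in the standard basis. *)
Lemma dir_derivative_gradient n p (X : 'M[R]_(n, p)) (f : 'cV[R]_n -> R) (b h : 'cV[R]_p) :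
  differentiable f (X *m b) ->
  dir_derivative (fun b => f (X *m b)) b h = dotv (gradient f (X *m b)) (X *m h).
Proof.
move=> df; have /(_ (X *m h)) dv := diff_derivable df.
transitivity ('D_(X *m h) f (X *m b)).
  apply/cvg_lim => //; have := cvg_dnbhs_at_right dv.
  apply: cvg_trans; apply: near_eq_cvg; near=> e.
  rewrite /dir_quotient /= mulmxDr -scalemxAr (addrC (X *m b)).
  by rewrite /GRing.scale/= mulrC.
rewrite deriveE// [in LHS](_ : X *m h = \sum_i (X *m h) i 0 *: delta_mx i 0).
  rewrite linear_sum; apply: eq_bigr => i _.
  by rewrite linearZ [in RHS]mulrC [X in _ = _ * X]mxE deriveE.
apply/colP => i; rewrite summxE (bigD1 i)//= big1 ?addr0 => [|j ji].
  by rewrite !mxE !eqxx mulr1.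
by rewrite !mxE eq_sym (negbTE ji) mulr0.
Unshelve. all: by end_near. Qed.

End DirectionalDerivative.

(** * First-order inequality at a fixed point of the surrogate *)

Section FixedPoint.
Context {R : realType}.
Variables (p : nat) (l psi : 'cV[R]_p -> R) (Theta : R -> R -> R) (rho lambda : R).
Hypotheses (dl : dir_differentiable l) (dpsi : dir_differentiable psi).
Hypotheses (hT : thresholding Theta) (l0 : 0 <= lambda).

Lemma vec_penalty_semiconvex (b h : 'cV[R]_p) s : 0 <= s <= 1 ->
  vec_penalty (P_Theta Theta) (rho *: (b + s *: h)) lambda
  <= (1 - s) * vec_penalty (P_Theta Theta) (rho *: b) lambda
     + s * vec_penalty (P_Theta Theta) (rho *: (b + h)) lambda
     + s * (1 - s) * (rho ^+ 2 * L_Theta Theta lambda * (norm2 h ^+ 2 / 2)).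
Proof.
move=> s01; rewrite sqr_norm2 /vec_penalty /dotv !(mulr_sumr, mulr_suml).
rewrite -!big_split/= ler_sum// => j _.
have := P_Theta_semiconvex hT l0 ((rho *: b) j 0) ((rho *: (b + h)) j 0) s01.
rewrite !mxE (_ : rho * b j 0 + s * (rho * (b j 0 + h j 0) - rho * b j 0) =
  rho * (b j 0 + s * h j 0)); last by ring.
set Pc := P_Theta _ _ _; set Pa := P_Theta _ _ _; set Pb := P_Theta _ _ _.
by lra.
Qed.

Lemma fixed_point_ineq (b g : 'cV[R]_p) :
  argmin (fun b' => surrogate l psi Theta rho lambda b' b) b ->
  vec_penalty (P_Theta Theta) (rho *: b) lambda
    <= vec_penalty (P_Theta Theta) (rho *: g) lambda + dir_derivative l b (g - b)
       + rho ^+ 2 * L_Theta Theta lambda * D2 b g.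
Proof.
move=> minb; set Vb := vec_penalty _ _ _; set Vg := vec_penalty _ _ _.
set h := g - b; set Q := _ * D2 b g.
have QE : Q = rho ^+ 2 * L_Theta Theta lambda * (norm2 h ^+ 2 / 2).
  by rewrite /Q /D2 -norm2N opprB.
(* By semiconvexity this expression is at least the increase of the surrogate from [b] to
   [b + s *: h] divided by [s]. It is thus nonnegative for [0 < s < 1], and so is its limit. *)
have lim_ : dir_quotient l b h s + (dir_quotient psi b h s - dir_derivative psi b h)
    + (Vg - Vb + (1 - s) * Q) @[s --> 0^'+]
    --> dir_derivative l b h + (dir_derivative psi b h - dir_derivative psi b h)
        + (Vg - Vb + (1 - 0) * Q).
  apply: cvgD; [apply: cvgD; [exact: dl|apply: cvgB; [exact: dpsi|exact: cvg_cst]]|].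
  apply: cvgD; [exact: cvg_cst|apply: cvgM; [|exact: cvg_cst]].
  apply: cvgB; [exact: cvg_cst|].
  by apply: cvg_at_right_filter; exact: cvg_id.
suff : 0 <= dir_derivative l b h + (dir_derivative psi b h - dir_derivative psi b h)
        + (Vg - Vb + (1 - 0) * Q) by lra.
apply: (cvgr_to_ge lim_); near=> s.
have s0 : 0 < s by near: s; exact: nbhs_right_gt.
have s1 : s < 1 by near: s; exact: nbhs_right_lt.
rewrite -(pmulr_rge0 _ s0).
have := minb (b + s *: h); rewrite /surrogate/= gen_bregman_diag gen_bregman_step//.
have s01 : 0 <= s <= 1 by rewrite !ltW.
have := vec_penalty_semiconvex b h s01; rewrite -QE -/Vb.
rewrite (_ : b + h = g) ?subrKC// -/Vg; set Vs := vec_penalty _ _ _.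
have -> : s * (dir_quotient l b h s + (dir_quotient psi b h s - dir_derivative psi b h) +
   (Vg - Vb + (1 - s) * Q)) = (l (b + s *: h) - l b) +
  s * (dir_quotient psi b h s - dir_derivative psi b h) + s * (Vg - Vb + (1 - s) * Q).
  by rewrite /dir_quotient; field; rewrite gt_eqF.
lra.
Unshelve. all: by end_near. Qed.

End FixedPoint.

(** * Deterministic absorption of the noise by the hard penalty and the prediction error *)

Section NoiseAbsorption.
Context {R : realType}.

Lemma P_H_ge0 (t lambda : R) : 0 <= lambda -> 0 <= P_H t lambda.
Proof.
move=> l0; rewrite /P_H; case: ifPn => [tl|_]; last by rewrite divr_ge0// sqr_ge0.
have := normr_ge0 t; have := real_normK (num_real t); nra.
Qed.

(** Below the threshold the penalty is [|t| * (lambda - |t| / 2)], and the bracket is at least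
    [lambda / 2], hence at least [|t| / 2]. *)
Lemma P_H_small (t lambda : R) : `|t| < lambda ->
  lambda * `|t| / 2 <= P_H t lambda /\ t ^+ 2 / 2 <= P_H t lambda.
Proof.
move=> tl; rewrite /P_H tl.
by have := normr_ge0 t; have := real_normK (num_real t); split; nra.
Qed.

(* Entries with [lambda <= |rho * h j|] are charged to the flat part of the
   penalty, at cost [lambda ^+ 2 / 2] each; on the others the penalty dominates
   both the l1 norm and the squared l2 norm. *)
Lemma noise_absorption n p (X : 'M[R]_(n, p)) (rho M lambda delta vtheta : R)
    (eps : 'cV[R]_n) (h : 'cV[R]_p) :
  0 < rho -> 0 <= M -> 0 <= lambda -> 0 < delta -> 0 < vtheta ->
  8 * M <= lambda * vtheta -> 64 * M ^+ 2 <= lambda ^+ 2 * delta * vtheta ->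
  (forall v : 'cV[R]_p, norm2 (X *m v) <= rho * norm2 v) ->
  (forall (S : {set 'I_p}) (v : 'cV[R]_p), (forall j, j \notin S -> v j 0 = 0) ->
     dotv eps (X *m v) <= M * Num.sqrt #|S|%:R * norm2 (X *m v)) ->
  dotv eps (X *m h) <= delta / 2 * (norm2 (X *m h) ^+ 2 / 2)
    + vtheta / 2 * vec_penalty P_H (rho *: h) lambda.
Proof.
move=> rho0 M0 l0 d0 v0 Mv Mdv Xrho epsM.
pose S := [set j : 'I_p | lambda <= `|rho * h j 0|]%SET.
pose q j := if j \in S then 0 else P_H (rho * h j 0) lambda.
pose Q := \sum_j q j.
pose k : R := #|S|%:R.
have k0 : 0 <= k by [].
have penE : vec_penalty P_H (rho *: h) lambda = k * (lambda ^+ 2 / 2) + Q.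
  rewrite /Q /vec_penalty [in RHS](bigID (mem S))/= [in RHS]big1 => [|j jS]; last first.
    by rewrite /q jS.
  rewrite add0r (bigID (mem S))/=; congr (_ + _).
    rewrite (eq_bigr (fun=> lambda ^+ 2 / 2)) => [|j].
      by rewrite sumr_const /k mulr_natl.
    by rewrite inE mxE /P_H leNgt => /negbTE ->.
  by apply: eq_bigr => j jS; rewrite /q (negbTE jS) mxE.
pose u : 'cV[R]_p := \col_j (if j \in S then h j 0 else 0).
pose w : 'cV[R]_p := \col_j (if j \in S then 0 else h j 0).
have huw : h = u + w.
  by apply/colP => j; rewrite !mxE; case: ifP; rewrite ?addr0 ?add0r.
have small j : j \notin S -> `|rho * h j 0| < lambda by rewrite inE -ltNge.
have epsw : dotv eps (X *m w) <= vtheta / 4 * Q.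
  have -> : X *m w = \sum_j X *m (w j 0 *: delta_mx j 0).
    rewrite mulmx_cols; apply: eq_bigr => j _.
    by rewrite -scalemxAr colE.
  rewrite dotv_sumr /Q mulr_sumr ler_sum// => j _.
  (* Singleton supports treat the small entries one at a time, so that the l1 bound on the penalty
     pays for them. *)
  have /(_ [set j]%SET) := epsM _ (w j 0 *: delta_mx j 0).
  rewrite cards1 sqrtr1 mulr1 => H; apply: le_trans (H _) _.
    by move=> i; rewrite !inE !mxE => /negbTE ->; rewrite mulr0.
  have := Xrho (w j 0 *: delta_mx j 0); rewrite norm2Z norm2_delta mulr1 => Xj.
  apply: le_trans (ler_wpM2l M0 Xj) _.
  rewrite /q mxE; case: ifPn => [_|jS]; first by rewrite normr0 !mulr0.
  have [] := P_H_small (small _ jS); rewrite normrM gtr0_norm// => H1 _.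
  have x0 : 0 <= rho * `|h j 0| by rewrite mulr_ge0// ltW.
  have : 8 * M * (rho * `|h j 0|) <= lambda * vtheta * (rho * `|h j 0|) by rewrite ler_wpM2r.
  have : vtheta * (lambda * (rho * `|h j 0|) / 2) <= vtheta * P_H (rho * h j 0) lambda.
    by rewrite ler_pM2l.
  lra.
have Xw : norm2 (X *m w) ^+ 2 <= 2 * Q.
  apply: (@le_trans _ _ ((rho * norm2 w) ^+ 2)).
    by rewrite ler_pXn2r// ?nnegrE ?mulr_ge0 ?norm2_ge0// ltW.
  rewrite exprMn sqr_norm2 /dotv /Q !mulr_sumr ler_sum// => j _.
  rewrite /q mxE; case: ifPn => [_|jS]; first by rewrite !mulr0.
  have [_] := P_H_small (small _ jS); rewrite exprMn; lra.
set x := norm2 (X *m h); set y := norm2 (X *m w) in Xw.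
have x0 : 0 <= x := norm2_ge0 _.
have y0 : 0 <= y := norm2_ge0 _.
set s := M * Num.sqrt k.
have s0 : 0 <= s by rewrite mulr_ge0// sqrtr_ge0.
have s2 : s ^+ 2 = M ^+ 2 * k by rewrite exprMn sqr_sqrtr.
have epsu : dotv eps (X *m u) <= s * (x + y).
  apply: le_trans (epsM S u _) _; first by move=> j jS; rewrite mxE (negbTE jS).
  rewrite -/k -/s ler_wpM2l//.
  have -> : X *m u = X *m h + - (X *m w) by rewrite huw mulmxDr addrK.
  by rewrite (le_trans (ler_norm2D _ _))// norm2N.
have sk : 64 * s ^+ 2 <= lambda ^+ 2 * delta * vtheta * k.
  by rewrite s2 mulrA ler_wpM2r.
have sk' : 64 * s ^+ 2 <= lambda ^+ 2 * vtheta ^+ 2 * k.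
  rewrite s2 mulrA ler_wpM2r//.
  have : (8 * M) ^+ 2 <= (lambda * vtheta) ^+ 2.
    by rewrite ler_pXn2r// ?nnegrE ?mulr_ge0// ltW.
  by rewrite !exprMn; lra.
(* Two Young inequalities. The square of [x] uses up the prediction term; that of [y] costs
   [vtheta / 4 * Q], which together with [epsw] exhausts [vtheta / 2 * Q]. The remainders total
   [3 / 64] of [lambda ^+ 2 * vtheta * k], of which [1 / 4] is available. *)
have sx : s * x <= delta / 4 * x ^+ 2 + lambda ^+ 2 * vtheta * k / 64.
  have H : 0 <= (delta / 2 * x - s) ^+ 2 by exact: sqr_ge0.
  rewrite -(ler_pM2l d0); lra.
have sy : s * y <= vtheta / 8 * y ^+ 2 + 2 * (lambda ^+ 2 * vtheta * k / 64).
  have H : 0 <= (vtheta / 4 * y - s) ^+ 2 by exact: sqr_ge0.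
  rewrite -(ler_pM2l v0); lra.
have yQ : vtheta * y ^+ 2 <= vtheta * (2 * Q) by rewrite ler_pM2l.
have lk : 0 <= lambda ^+ 2 * vtheta * k by rewrite !mulr_ge0 ?sqr_ge0// ltW.
rewrite [in leLHS]huw mulmxDr dotvDr penE; lra.
Qed.

End NoiseAbsorption.

(** * Estimation error bounded by noise *)

Section BasicInequality.
Context {R : realType}.

(** In [2 * sym_bregman] the values of [l] cancel and two directional derivatives remain: the one at
    [bhat] cancels against [fixed_point_ineq], together with the curvature and penalty terms, and
    the one at [bstar] is the noise. *)
Lemma fixed_point_basic_ineq n p (X : 'M[R]_(n, p)) (rho lambda delta vtheta K' : R)
    (l0 : 'cV[R]_n -> R) (psi : 'cV[R]_p -> R) (Theta : R -> R -> R) (bstar bhat : 'cV[R]_p) :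
  let l := fun b => l0 (X *m b) in
  dir_differentiable l -> dir_differentiable psi -> thresholding Theta -> 0 <= lambda ->
  differentiable l0 (X *m bstar) ->
  (forall b : 'cV[R]_p,
     rho ^+ 2 * L_Theta Theta lambda * D2 b bstar
       + delta * D2 (X *m b) (X *m bstar)
       + vtheta * vec_penalty P_H (rho *: (b - bstar)) lambda
       + vec_penalty (P_Theta Theta) (rho *: bstar) lambda
     <= 2 * sym_bregman l b bstar + vec_penalty (P_Theta Theta) (rho *: b) lambda + K') ->
  argmin (fun b => surrogate l psi Theta rho lambda b bhat) bhat ->
  delta * D2 (X *m bhat) (X *m bstar)
    + vtheta * vec_penalty P_H (rho *: (bhat - bstar)) lambda
  <= dotv (- gradient l0 (X *m bstar)) (X *m (bhat - bstar)) + K'.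
Proof.
move=> l dl dpsi hT lam0 dl0 hyp amin.
have := fixed_point_ineq dl dpsi hT lam0 bstar amin.
have := hyp bhat; rewrite /sym_bregman /gen_bregman dotvNl -dir_derivative_gradient// -/l.
lra.
Qed.

End BasicInequality.

(** * Tail bounds for sub-Gaussian variables and the union bound *)

Section SubGaussianTail.
Context {d : measure_display} {T : measurableType d} {R : realType}.
Variable P : probability T R.

Lemma measurable_fun_gt_cst (f : T -> R) t : measurable_fun setT f ->
  measurable [set w | t < f w].
Proof.
move=> mf; rewrite (_ : [set _ | _] = ~` [set w | f w <= t]).
  by apply: measurableC; rewrite -[X in measurable X]setTI; exact: measurable_fun_le.
by apply/seteqP; split=> w /=; rewrite ltNge => /negP.
Qed.

(** The infimum lies below [s'], so some admissible scale [r < s'] exists; Markov's inequality for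
    [expR (xi ^+ 2 / r ^+ 2)] does the rest. *)
Lemma psi2_tail (xi : T -> R) (s s' t : R) : measurable_fun setT xi ->
  (psi2_norm P xi <= s%:E)%E -> s < s' -> 0 < s' -> 0 <= t ->
  (P [set w | (t <= xi w)%R] <= (2 * expR (- (t ^+ 2 / s' ^+ 2)))%:E)%E.
Proof.
move=> mxi xis ss' s'0 t0.
have : (psi2_norm P xi < s'%:E)%E by rewrite (le_lt_trans xis)// lte_fin.
move=> /ereal_inf_lt[_ [r [r0 Er] <-]]; rewrite lte_fin => rs'.
pose X w := expR (xi w ^+ 2 / r ^+ 2).
have mX : measurable_fun setT X.
  apply: measurableT_comp => //; apply: measurable_funM => //.
  exact: measurable_funX.
have mA : measurable [set w | t <= xi w].
  by rewrite -[X in measurable X]setTI; exact: measurable_fun_le.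
pose a := expR (t ^+ 2 / r ^+ 2).
have aA : (a%:E * P [set w | (t <= xi w)%R] <= 2%:E)%E.
  rewrite -integral_cst//; apply: le_trans Er; rewrite unlock.
  apply: (@le_trans _ _ (\int[P]_(w in [set w | (t <= xi w)%R]) (X w)%:E)%E).
    apply: ge0_le_integral => //.
    - by move=> w _; rewrite lee_fin expR_ge0.
    - by apply/measurable_EFinP; exact: measurable_funTS.
    - move=> w /= tw; rewrite lee_fin ler_expR ler_pM2r ?invr_gt0 ?exprn_gt0//.
      by rewrite ler_pXn2r// nnegrE// (le_trans t0).
  apply: ge0_subset_integral => //; first exact/measurable_EFinP.
  by move=> w _; rewrite lee_fin expR_ge0.
have a0 : 0 < a by exact: expR_gt0.
have PA : P [set w | t <= xi w] \is a fin_num by exact: fin_num_measure.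
rewrite -(fineK PA) in aA *; rewrite lee_fin; rewrite -EFinM lee_fin in aA.
rewrite expRN; apply: (@le_trans _ _ (2 * a^-1)).
  by rewrite ler_pdivlMr// mulrC.
rewrite ler_pM2l// lef_pV2 ?posrE ?expR_gt0// ler_expR ler_wpM2l ?sqr_ge0//.
by rewrite lef_pV2 ?posrE ?exprn_gt0// ler_pXn2r ?nnegrE// ltW.
Qed.

Lemma psi2_deviation (xi : T -> R) (s r : R) : measurable_fun setT xi -> 0 <= s ->
  (psi2_norm P xi <= s%:E)%E -> 0 <= r ->
  (P [set w | (s * r < xi w)%R] <= (2 * expR (- (r ^+ 2 / 4)))%:E)%E.
Proof.
move=> mxi s0 xis r0.
have mge t : measurable [set w | t <= xi w].
  by rewrite -[X in measurable X]setTI; exact: measurable_fun_le.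
have [s_gt0|s_le0] := ltP 0 s.
  (* Doubling the scale provides the strict inequality and accounts for the 4 in the exponent. *)
  have ss : s < 2 * s by lra.
  have s2 : 0 < 2 * s by lra.
  have := psi2_tail mxi xis ss s2 (mulr_ge0 s0 r0).
  rewrite (_ : (s * r) ^+ 2 / (2 * s) ^+ 2 = r ^+ 2 / 4); last by field; rewrite gt_eqF.
  apply: le_trans; apply: le_measure; rewrite ?inE//.
    exact: measurable_fun_gt_cst.
  by move=> w /=; exact: ltW.
have {s_le0} s0' : s = 0 by apply/eqP; rewrite eq_le s0 s_le0.
rewrite s0' mul0r; rewrite s0' in xis.
(* Scale zero forces [xi <= 0] almost surely. The scale with square [t ^+ 2 * e / 2] makes the tail
   at most [2 * expR (- (2 / e))], which is below [e]; countably many thresholds then exhaust the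
   positive values. *)
have P0 t : 0 < t -> P [set w | t <= xi w] = 0%E.
  move=> t0; apply/eqP; rewrite eq_le measure_ge0 andbT.
  apply/lee_addgt0Pr => e e0; rewrite add0e.
  have u0 : 0 < t ^+ 2 * e / 2 by rewrite divr_gt0// mulr_gt0// exprn_gt0.
  have v0 : 0 < Num.sqrt (t ^+ 2 * e / 2) by rewrite sqrtr_gt0.
  apply: le_trans (psi2_tail mxi xis v0 v0 (ltW t0)) _.
  rewrite lee_fin sqr_sqrtr; last exact: ltW.
  have -> : t ^+ 2 / (t ^+ 2 * e / 2) = 2 / e by field; rewrite !gt_eqF.
  rewrite expRN ler_pdivrMr ?expR_gt0//.
  apply: (@le_trans _ _ (e * (1 + 2 / e))).
    by rewrite mulrDr mulr1 mulrC divfK ?gt_eqF//; lra.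
  by rewrite ler_pM2l// expR_ge1Dx.
rewrite (_ : [set w | 0 < xi w] = \bigcup_n [set w | n.+1%:R^-1 <= xi w]).
  rewrite (_ : P _ = 0%E) ?lee_fin ?mulr_ge0 ?expR_ge0//.
  apply: measure_negligible; first exact: bigcup_measurable.
  apply: negligible_bigcup => n; apply/negligibleP => //.
  by apply: P0; rewrite invr_gt0.
apply/seteqP; split => w /=.
  move=> xw; exists (Num.truncn (xi w)^-1) => //=.
  rewrite -[leRHS]invrK lef_pV2 ?posrE ?invr_gt0//.
  by apply/ltW; rewrite truncnS_gt.
by case=> n _ /=; apply: lt_le_trans; rewrite invr_gt0.
Qed.

Lemma probability_union_bound (I : Type) (r : seq I) (Q : pred I)
    (B : I -> set T) (b : I -> R) :
  (forall i, measurable (B i)) -> (forall i, Q i -> (P (B i) <= (b i)%:E)%E) ->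
  (P (\big[setU/set0]_(i <- r | Q i) B i) <= (\sum_(i <- r | Q i) b i)%:E)%E.
Proof.
move=> mB Bb; elim: r => [|i r IH]; first by rewrite !big_nil measure0.
rewrite !big_cons; case: ifPn => // Qi.
rewrite EFinD (le_trans (measureU2 _ _ _))//; first exact: bigsetU_measurable.
by rewrite leeD// Bb.
Qed.

End SubGaussianTail.

(** * Grids in the column spans *)

Section GridNet.
Context {R : realType}.

(** Gram-Schmidt runs on all [p] columns with those outside [S] replaced by zero; the output keeps
    the column indices and vanishes off [S]. *)
Lemma span_orthonormal_expansion n p (X : 'M[R]_(n, p)) (S : {set 'I_p}) :
  exists e : 'I_p -> 'cV[R]_n,
  [/\ forall i j, i != j -> dotv (e i) (e j) = 0,
      forall i, dotv (e i) (e i) <= 1,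
      forall i, i \notin S -> e i = 0 &
      forall v : 'cV[R]_p, (forall j, j \notin S -> v j 0 = 0) ->
        X *m v = \sum_i dotv (X *m v) (e i) *: e i].
Proof.
pose x (i : nat) : 'cV[R]_n := oapp (fun j => if j \in S then col j X else 0) 0 (insub i).
have xE (j : 'I_p) : x j = if j \in S then col j X else 0 by rewrite /x valK.
have [e [e1 e2 e3 e4]] := gram_schmidt x p.
exists (fun i => e i); split => [i j ij|i|i iS|v vS].
- exact: e1.
- exact: e2.
- by apply: e3; rewrite xE (negbTE iS).
- have Xv : X *m v = \sum_j v j 0 *: x j.
    rewrite mulmx_cols; apply: eq_bigr => j _; rewrite xE.
    by case: ifPn => // /vS ->; rewrite !scale0r.
  pose F j := \sum_(i < p) (v j 0 * dotv (x j) (e i)) *: e i.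
  rewrite Xv [LHS](eq_bigr F) => [|j _].
    rewrite exchange_big; apply: eq_bigr => i _.
    rewrite -scaler_suml; congr (_ *: _).
    by rewrite [RHS]dotvC dotv_sumr; apply: eq_bigr => j _; rewrite dotvZr dotvC.
  rewrite [in LHS](e4 j) ?ltn_ord// scaler_sumr; apply: eq_bigr => i _.
  by rewrite scalerA.
Qed.

Lemma norm2_orthonormal_comb n p (e : 'I_p -> 'cV[R]_n) (c : 'cV[R]_p) :
  (forall i j, i != j -> dotv (e i) (e j) = 0) ->
  norm2 (\sum_i c i 0 *: e i) ^+ 2 = \sum_i c i 0 ^+ 2 * dotv (e i) (e i).
Proof.
move=> eo; rewrite sqr_norm2 dotv_sumr; apply: eq_bigr => i _.
rewrite dotvZr dotvC dotv_sumr (bigD1 i)//= big1 ?addr0 => [|j ji].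
  by rewrite dotvZr; ring.
by rewrite dotvZr eo ?mulr0// eq_sym.
Qed.

(** The grid consists of the integers from [- 2 p] to [2 p]. [None] marks an index outside the
    support, as opposed to [Some] index whose coefficient happens to be 0. *)
Definition grid_coef (p : nat) (o : option 'I_(4 * p).+1) : R :=
  oapp (fun i : 'I_(4 * p).+1 => i%:R - (2 * p)%:R) 0 o.

Lemma grid_round p (a : R) : `|a| <= (2 * p)%:R ->
  exists i : 'I_(4 * p).+1, 0 <= a - grid_coef (Some i) <= 1.
Proof.
rewrite ler_norml => /andP[a1 a2].
have b0 : 0 <= a + (2 * p)%:R by lra.
have /andP[t1 t2] := truncn_itv b0.
have tp : (Num.truncn (a + (2 * p)%:R) < (4 * p).+1)%N.
  rewrite ltnS -(ler_nat R) (le_trans t1)//.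
  have -> : (4 * p = 2 * p + 2 * p)%N by rewrite -mulnDl.
  by rewrite natrD lerD2r.
exists (Ordinal tp); rewrite /grid_coef /= .
by move: t2; rewrite -natr1; lra.
Qed.

Definition grid_support p (g : {ffun 'I_p -> option 'I_(4 * p).+1}) : {set 'I_p} :=
  [set i | g i != None]%SET.

(* The coordinates of the noise in [S], scaled to have norm [2 * sqrt #|S|] and
   rounded, stay within [sqrt #|S|] of themselves: so the grid direction nearest
   to the projected noise detects a fixed proportion of its norm. *)
Lemma grid_projection_bound n p (e : 'I_p -> 'cV[R]_n) (S : {set 'I_p})
    (eps : 'cV[R]_n) (sr : R) :
  0 <= sr ->
  (forall i j, i != j -> dotv (e i) (e j) = 0) ->
  (forall i, dotv (e i) (e i) <= 1) ->
  (forall i, i \notin S -> e i = 0) ->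
  (forall g : {ffun 'I_p -> option 'I_(4 * p).+1}, grid_support g = S ->
     dotv eps (\sum_i grid_coef (g i) *: e i)
       <= norm2 (\sum_i grid_coef (g i) *: e i) * (sr * Num.sqrt #|S|%:R)) ->
  norm2 (\col_i dotv eps (e i)) <= 3 * sr * Num.sqrt #|S|%:R.
Proof.
move=> sr0 eo e1 eS H; set z := \col_i _; set k : R := Num.sqrt _.
have k0 : 0 <= k by exact: sqrtr_ge0.
have zS i : i \notin S -> z i 0 = 0 by move=> iS; rewrite mxE eS// dotv0r.
have [z0|zn0] := eqVneq (norm2 z) 0; first by rewrite z0 !mulr_ge0.
have z0 : 0 < norm2 z by rewrite lt_def zn0 norm2_ge0.
(* Entries of the scaled vector are at most [2 * k], which this brings into the range of the
   grid. *)
have kp : k <= p%:R.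
  rewrite -[leRHS]ger0_norm// -sqrtr_sqr ler_wsqrtr// -natrX ler_nat.
  rewrite (leq_trans (max_card _))// card_ord expnS expn1.
  by case: (p) => // p'; rewrite leq_pmull.
have kgt0 : 0 < k.
  rewrite sqrtr_gt0 ltr0n card_gt0; apply: contra zn0 => /eqP S0.
  rewrite (_ : z = 0) ?/norm2 ?dotv0r ?sqrtr0//.
  by apply/colP => i; rewrite zS ?S0 ?inE// mxE.
(* Length [2 * k] against a rounding error of at most [k]: the inner product with [z] keeps
   [k * norm2 z], while [c] has norm at most [3 * k], whence the factor 3. *)
pose a := (2 * k / norm2 z) *: z.
have na : norm2 a = 2 * k.
  by rewrite norm2Z ger0_norm ?divr_ge0 ?mulr_ge0 ?norm2_ge0// divfK.
have ap j : `|a j 0| <= (2 * p)%:R.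
  by rewrite (le_trans (ler_entry_norm2 _ _))// na natrM ler_pM2l.
have [f fP] := choice (fun j => grid_round (ap j)).
pose g : {ffun 'I_p -> option 'I_(4 * p).+1} :=
  [ffun j => if j \in S then Some (f j) else None].
have gS : grid_support g = S.
  by apply/setP => j; rewrite inE ffunE; case: ifP.
pose c : 'cV[R]_p := \col_j grid_coef (g j).
have cE : \sum_i grid_coef (g i) *: e i = \sum_i c i 0 *: e i.
  by apply: eq_bigr => i _; rewrite [in RHS]mxE.
have := H g gS; rewrite cE => {}H.
have nc : norm2 (\sum_i c i 0 *: e i) <= norm2 c.
  rewrite -(@ler_pXn2r _ 2)// ?nnegrE ?norm2_ge0// norm2_orthonormal_comb//.
  by rewrite sqr_norm2 ler_sum// => i _; rewrite -expr2 ler_piMr// sqr_ge0.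
have epsc : dotv eps (\sum_i c i 0 *: e i) = dotv c z.
  rewrite dotv_sumr; apply: eq_bigr => i _.
  by rewrite dotvZr [z i 0]mxE.
pose b := a - c.
have nb : norm2 b <= k.
  rewrite ler_wsqrtr// /dotv (bigID (mem S))/= [X in _ + X]big1 => [|i iS]; last first.
    by rewrite !mxE ffunE (negbTE iS)/= eS// dotv0r mulr0 subr0 mul0r.
  rewrite addr0 -sumr_const ler_sum// => i iS.
  have := fP i; rewrite [b i 0]mxE [(- c) i 0]mxE [c i 0]mxE ffunE iS => /andP[x0 x1].
  by rewrite mulr_ile1.
have cab : c = a + - b by rewrite /b opprB subrKC.
have nc3 : norm2 c <= 3 * k.
  by rewrite cab (le_trans (ler_norm2D _ _))// norm2N na; lra.
have cz : k * norm2 z <= dotv c z.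
  rewrite cab dotvDl dotvNl /a dotvZl -sqr_norm2.
  have -> : 2 * k / norm2 z * norm2 z ^+ 2 = 2 * k * norm2 z by field.
  have := dotv_le_norm2 b z.
  have : norm2 b * norm2 z <= k * norm2 z by rewrite ler_pM2r.
  lra.
rewrite -(ler_pM2l kgt0) (le_trans cz)// -epsc (le_trans H)//.
rewrite (le_trans (ler_wpM2r _ (le_trans nc nc3))) ?mulr_ge0//.
by rewrite -/k [leLHS](_ : _ = k * (3 * sr * k))//; ring.
Qed.

End GridNet.

(** * The high-probability event controlling the noise on all supports *)

Section NetEvent.
Context {d : measure_display} {T : measurableType d} {R : realType}.
Variable P : probability T R.

Lemma measurable_dotv n (xi : T -> 'cV[R]_n) a : random_vector xi ->
  measurable_fun setT (fun w => dotv (xi w) a).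
Proof.
move=> mxi; apply: measurable_sum => i.
by apply: measurable_funM => //; exact: mxi.
Qed.

(* Summing [q ^ #|support|] over all grid points factors over the coordinates,
   each contributing [1] (absent) plus [4 p + 1] times [q] (present). *)
Lemma sum_grid_support p (q : R) :
  \sum_(g : {ffun 'I_p -> option 'I_(4 * p).+1}) q ^+ #|grid_support g|
  = (1 + (4 * p).+1%:R * q) ^+ p.
Proof.
pose F (o : option 'I_(4 * p).+1) := if o != None then q else 1.
have -> : (1 + (4 * p).+1%:R * q) ^+ p = \prod_(i < p) \sum_o F o.
  rewrite prodr_const card_ord; congr (_ ^+ _).
  rewrite (bigD1 None)//= (eq_bigr (fun=> q)) => [|o]; last by rewrite /F => ->.
  by rewrite sumr_const cardC1 card_option card_ord /= mulr_natl.
rewrite bigA_distr_bigA/=; apply: eq_bigr => g _.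
by rewrite /F -big_mkcond/= prodr_const; congr (_ ^+ _); apply: eq_card => i; rewrite !inE.
Qed.

(** Off the events [B g], [grid_projection_bound] applies to every support at once. The square root
    of the support size in the level of [B g] gives it probability at most [2 * q ^+ k] for support
    size [k], and [sum_grid_support] adds these up. *)
Lemma net_event n p (X : 'M[R]_(n, p)) (eps : T -> 'cV[R]_n) (sigma r : R) :
  random_vector eps -> 0 <= sigma -> sub_gaussian P eps sigma -> 0 <= r ->
  exists E : set T, [/\ measurable E,
    ((1 - 2 * ((1 + (4 * p).+1%:R * expR (- (r ^+ 2 / 4))) ^+ p - 1))%:E <= P E)%E &
    forall w, E w -> forall (S : {set 'I_p}) (v : 'cV[R]_p),
      (forall j, j \notin S -> v j 0 = 0) ->
      dotv (eps w) (X *m v) <= 3 * (sigma * r) * Num.sqrt #|S|%:R * norm2 (X *m v)].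
Proof.
move=> meps s0 sg r0.
have [e eP] := choice (span_orthonormal_expansion X).
pose u (g : {ffun 'I_p -> option 'I_(4 * p).+1}) : 'cV[R]_n :=
  \sum_i grid_coef (g i) *: e (grid_support g) i.
pose B g := [set w | sigma * norm2 (u g) * (r * Num.sqrt #|grid_support g|%:R)
                     < dotv (eps w) (u g)].
pose q := expR (- (r ^+ 2 / 4)).
have mB g : measurable (B g) by apply/measurable_fun_gt_cst/measurable_dotv.
have PB g : (P (B g) <= (2 * q ^+ #|grid_support g|)%:E)%E.
  apply: le_trans (psi2_deviation (measurable_dotv _ meps) _ (sg _) _) _.
  - by rewrite mulr_ge0 ?norm2_ge0.
  - by rewrite mulr_ge0 ?sqrtr_ge0.
  - rewrite lee_fin exprMn sqr_sqrtr// /q -expRM_natl.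
    by rewrite ler_pM2l// ler_expR; lra.
pose G := grid_support.
(* The empty support is left out: it would contribute [q ^+ 0 = 1] to the sum, which is the 1
   subtracted in the bound. *)
exists (~` \big[setU/set0]_(g | G p g != finset.set0) B g); split.
- by apply: measurableC; apply: bigsetU_measurable.
- rewrite probability_setC; last by apply: bigsetU_measurable.
  rewrite EFinB leeB//.
  apply: le_trans (probability_union_bound (index_enum _) mB (fun g _ => PB g)) _.
  rewrite lee_fin -mulr_sumr ler_pM2l// -sum_grid_support lerBrDr.
  rewrite [leRHS](bigID (fun g => G p g != finset.set0))/= lerD2l.
  rewrite (bigD1 [ffun=> None])/= ?negbK; last first.
    by apply/eqP/setP => i; rewrite !inE ffunE.
  rewrite (_ : grid_support _ = finset.set0) ?cards0 ?expr0 ?lerDl ?sumr_ge0//.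
  by apply/setP => i; rewrite !inE ffunE.
- move=> w Ew S v vS; have [eo e1 eS ev] := eP S.
  set z := \col_i dotv (eps w) (e S i).
  have zle : norm2 z <= 3 * (sigma * r) * Num.sqrt #|S|%:R.
    apply: grid_projection_bound => //; first exact: mulr_ge0.
    move=> g gS; rewrite leNgt; apply/negP => H; apply: Ew.
    have [S0|Sn0] := eqVneq S finset.set0.
      move: H; rewrite big1 => [|i _]; last by rewrite eS ?S0 ?inE// scaler0.
      by rewrite dotv0r /norm2 dotv0r sqrtr0 mul0r ltxx.
    rewrite (bigD1 g)/=; last by rewrite /G gS.
    left; rewrite /B /= /u gS; move: H; congr (_ < _).
    by ring.
  set y := X *m v; have yE : y = \sum_i dotv y (e S i) *: e S i := ev v vS.
  (* Pairing with [y] sees only the coordinates [z] of the noise in the basis, so Cauchy-Schwarz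
     concludes. *)
  have -> : dotv (eps w) y = dotv (\col_i dotv y (e S i)) z.
    rewrite {1}yE dotv_sumr; apply: eq_bigr => i _.
    by rewrite dotvZr [in RHS]mxE [z i 0]mxE.
  have ny : norm2 (\col_i dotv y (e S i)) = norm2 y.
    rewrite /norm2; congr Num.sqrt; rewrite [X in _ = dotv _ X]yE dotv_sumr.
    by apply: eq_bigr => i _; rewrite !mxE dotvZr.
  apply: le_trans (dotv_le_norm2 _ _) _; rewrite ny mulrC.
  by rewrite ler_wpM2r// norm2_ge0.
Qed.

End NetEvent.

(** * Numerical constants of the failure probability *)

Section Constants.
Context {R : realType}.

(** With [y = p x], the power is at most [expR y], which is at most [1 / (1 - y)] and so at most
    [1 + 2 y] for [y <= 1 / 2]. *)
Lemma expr1D_le (x : R) p : 0 <= x -> p%:R * x <= 1 / 2 ->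
  (1 + x) ^+ p - 1 <= 2 * (p%:R * x).
Proof.
move=> x0 px; set y := p%:R * x in px *.
have y0 : 0 <= y by exact: mulr_ge0.
have : (1 + x) ^+ p <= expR y.
  by rewrite /y expRM_natl lerXn2r// ?nnegrE ?expR_ge0 ?addr_ge0// expR_ge1Dx.
have ey : expR (- y) * expR y = 1 by rewrite -expRD addNr expR0.
have := expR_ge1Dx (- y); have := expR_gt0 y; nra.
Qed.

(* The number of grid points per coordinate costs two powers of [p], which are
   paid for by half of the exponent as soon as [A] is large. *)
Lemma failure_probability_le p (A : R) : (0 < p)%N -> 96 <= A ->
  2 * ((1 + (4 * p).+1%:R
            * expR (- ((A * Num.sqrt (log_ep p) / 24) ^+ 2 / 4))) ^+ p - 1)
  <= 20 * p%:R `^ (- (1 / 4608 * A ^+ 2)).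
Proof.
move=> p0 A96.
have pR : 0 < p%:R :> R by rewrite ltr0n.
have lnp0 : 0 <= ln (p%:R : R) by rewrite ln_ge0// ler1n.
have logE : log_ep p = 1 + ln p%:R :> R.
  by rewrite /log_ep lnM ?posrE ?expR_gt0// expRK.
(* Here [2304 = 24 ^ 2 * 4], and [96 ^ 2 = 4 * 2304] yields [a >= 4]. The target exponent, with
   constant [1 / 4608], is half of [a]. *)
pose a := A ^+ 2 / 2304.
have a4 : 4 <= a by rewrite /a; nra.
have -> : (A * Num.sqrt (log_ep p) / 24) ^+ 2 / 4 = a * (1 + ln p%:R).
  rewrite !exprMn sqr_sqrtr logE; last by rewrite addr_ge0.
  by rewrite /a; field.
rewrite /powR gt_eqF//; set L := ln p%:R in lnp0 *.
set q := expR (- _); set f := expR (- _ * L).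
have pE : p%:R = expR L :> R by rewrite /L lnK.
have m5 : (4 * p).+1%:R <= 5 * p%:R :> R.
  by rewrite -[5]/(5%:R) -natrM ler_nat -addn1 (_ : 5 * p = 4 * p + p)%N ?leq_add2l// -mulSnr.
have q0 : 0 < q by exact: expR_gt0.
have x5 : p%:R * ((4 * p).+1%:R * q) <= 5 * (p%:R ^+ 2 * q).
  have : (p%:R * q) * (4 * p).+1%:R <= (p%:R * q) * (5 * p%:R).
    by rewrite ler_pM2l// mulr_gt0.
  lra.
have aL : 4 * L <= a * L by rewrite ler_wpM2r.
have p2q : p%:R ^+ 2 * q = expR (2 * L - a * (1 + L)).
  by rewrite pE -expRM_natl -expRD.
have p2q_f : p%:R ^+ 2 * q <= f.
  by rewrite p2q ler_expR; move: aL a4; rewrite /a; lra.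
(* With the factor 5 of [x5], this provides the bound [1 / 2] required by [expr1D_le]; the final
   constant is [20 = 2 * 2 * 5]. *)
have p2q_10 : p%:R ^+ 2 * q <= 1 / 10.
  have e4 : 10 <= expR 4 :> R.
    have : expR 1 ^+ 4 <= expR 4 :> R by rewrite -expRM_natl mulr1.
    have e2 : 2 <= expR 1 :> R by have := expR_ge1Dx (1 : R); lra.
    have : 2 ^+ 4 <= expR 1 ^+ 4 :> R by rewrite lerXn2r// ?nnegrE ?expR_ge0.
    lra.
  apply: (@le_trans _ _ (expR (- 4))); first by rewrite p2q ler_expR; lra.
  by rewrite expRN div1r lef_pV2 ?posrE ?expR_gt0.
apply: le_trans (_ : 2 * (2 * (p%:R * ((4 * p).+1%:R * q))) <= _); last lra.
by rewrite ler_pM2l// expr1D_le ?mulr_ge0 ?(ltW q0)//; lra.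
Qed.

End Constants.

(** * Assembly of the oracle inequality *)

Theorem theorem3 (R : realType) :
  exists A0 C c : R, [/\ 0 < A0, 0 < C & 0 < c] /\
  forall (d : measure_display) (T : measurableType d) (P : probability T R)
    (n p : nat) (X : 'M[R]_(n, p)) (rho : R)
    (l0 : T -> 'cV[R]_n -> R) (Theta : R -> R -> R)
    (psi : T -> 'cV[R]_p -> R) (bstar : 'cV[R]_p)
    (sigma delta vtheta K A : R) (bhat : T -> 'cV[R]_p),
  let l := fun w (b : 'cV[R]_p) => l0 w (X *m b) in
  let eps := fun w => - gradient (l0 w) (X *m bstar) in
  let lambda := lambda_of p A sigma delta vtheta in
  (0 < n)%N -> (0 < p)%N ->
  spectral_norm X <= rho -> 0 < rho ->
  (forall w, dir_differentiable (l w)) ->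
  thresholding Theta ->
  (forall w, dir_differentiable (psi w)) ->
  (forall w, differentiable (l0 w) (X *m bstar)) ->
  random_vector eps -> mean_zero P eps ->
  0 <= sigma -> sub_gaussian P eps sigma ->
  0 < delta -> 0 < vtheta -> 0 <= K -> A0 <= A ->
  (forall w (b : 'cV[R]_p),
     rho ^+ 2 * L_Theta Theta lambda * D2 b bstar
       + delta * D2 (X *m b) (X *m bstar)
       + vtheta * vec_penalty P_H (rho *: (b - bstar)) lambda
       + vec_penalty (P_Theta Theta) (rho *: bstar) lambda
     <= 2 * sym_bregman (l w) b bstar
       + vec_penalty (P_Theta Theta) (rho *: b) lambda
       + K * lambda ^+ 2 * (norm0 bstar)%:R) ->
  (forall w, argmin (fun b => surrogate (l w) (psi w) Theta rho lambda b (bhat w))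
               (bhat w)) ->
  with_prob_at_least P (1 - C * p%:R `^ (- (c * A ^+ 2)))
    [set w |
      D2 (X *m bhat w) (X *m bstar)
        <= 2 * K * A ^+ 2 / (Num.min delta vtheta * delta * vtheta)
           * sigma ^+ 2 * (norm0 bstar)%:R * log_ep p
      /\ vec_penalty P_H (rho *: (bhat w - bstar)) lambda
        <= 4 * K * A ^+ 2 / (Num.min delta vtheta * vtheta ^+ 2)
           * sigma ^+ 2 * (norm0 bstar)%:R * log_ep p].
Proof.
exists 96, 20, (1 / 4608); split; first by split; lra.
move=> d T P n p X rho l0 Theta psi bstar sigma delta vtheta K A bhat l eps lambda.
move=> n0 p0 Xrho rho0 dl hT dpsi dl0 meps _ s0 sg d0 v0 K0 A96 hyp amin.
set D := Num.min delta vtheta.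
have D0 : 0 < D by rewrite lt_min d0.
have Dd : D <= delta by rewrite ge_min lexx.
have Dv : D <= vtheta by rewrite ge_min lexx orbT.
have A0 : 0 <= A by lra.
have log0 : 0 <= log_ep p :> R.
  by rewrite /log_ep ln_ge0// -[leLHS]mul1r ler_pM ?ler1n// -expR0 ler_expR.
have lam0 : 0 <= lambda by rewrite !mulr_ge0 ?invr_ge0 ?sqrtr_ge0.
(* The divisor [24 = 8 * 3] makes [8 * M] exactly [lambda] times the square root of [D * vtheta], so
   both conditions of [noise_absorption] follow from [D] being a minimum. *)
pose r := A * Num.sqrt (log_ep p) / 24.
have r0 : 0 <= r by rewrite !mulr_ge0 ?sqrtr_ge0.
pose M := 3 * (sigma * r).
have M0 : 0 <= M by rewrite !mulr_ge0.
have Dv0 : 0 < D * vtheta by rewrite mulr_gt0.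
have sDv0 : 0 < Num.sqrt (D * vtheta) by rewrite sqrtr_gt0.
have lam2 : lambda ^+ 2 = A ^+ 2 * sigma ^+ 2 * log_ep p / (D * vtheta).
  by rewrite /lambda /lambda_of !exprMn exprVn !sqr_sqrtr// ltW.
have M8 : 8 * M = lambda * Num.sqrt (D * vtheta).
  by rewrite /lambda /lambda_of divfK ?gt_eqF// /M /r; field.
have Mv : 8 * M <= lambda * vtheta.
  rewrite M8 ler_wpM2l// -[leRHS]ger0_norm ?(ltW v0)// -sqrtr_sqr ler_wsqrtr//.
  by rewrite expr2 ler_pM2r.
have Mdv : 64 * M ^+ 2 <= lambda ^+ 2 * delta * vtheta.
  have -> : 64 * M ^+ 2 = (8 * M) ^+ 2 by ring.
  rewrite M8 exprMn sqr_sqrtr ?(ltW Dv0)// -mulrA ler_wpM2l ?sqr_ge0//.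
  by rewrite ler_pM2r.
have [E [mE PE EP]] := net_event X meps s0 sg r0.
exists E; split => //; last first.
  apply: le_trans PE; rewrite lee_fin lerD2l lerN2.
  exact: failure_probability_le.
move=> w /EP {}EP /=.
have basic := fixed_point_basic_ineq (dl w) (dpsi w) hT lam0 (dl0 w) (hyp w) (amin w).
have noise := noise_absorption (bhat w - bstar) rho0 M0 lam0 d0 v0 Mv Mdv
  (fun v => norm2_mulmx_le v Xrho) EP.
set V := vec_penalty P_H _ _ in basic noise *.
have V0 : 0 <= V by apply: sumr_ge0 => j _; exact: P_H_ge0.
have D2E : norm2 (X *m (bhat w - bstar)) ^+ 2 / 2 = D2 (X *m bhat w) (X *m bstar).
  by rewrite /D2 mulmxBr.
set Y := D2 _ _ in basic D2E *; rewrite D2E in noise.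
have Y0 : 0 <= Y by rewrite -D2E divr_ge0 ?sqr_ge0.
set J := (norm0 bstar)%:R in basic *.
have J0 : 0 <= J by exact: ler0n.
pose Z := K * lambda ^+ 2 * J.
(* Half of each error term has paid for the noise. Each remaining half is bounded by [Z] on its own,
   giving the factor 2 and, with room to spare, the factor 4. *)
have sum_le : delta / 2 * Y + vtheta / 2 * V <= Z.
  by have := le_trans basic (lerD noise (lexx _)); rewrite /Z; lra.
have Z0 : 0 <= Z by rewrite !mulr_ge0 ?sqr_ge0.
split.
  have -> : 2 * K * A ^+ 2 / (D * delta * vtheta) * sigma ^+ 2 * J * log_ep p
      = 2 / delta * Z.
    by rewrite /Z lam2; field; rewrite !gt_eqF.
  have H : 0 <= vtheta / 2 * V by rewrite mulr_ge0// ltW// divr_gt0.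
  by rewrite mulrAC ler_pdivlMr//; lra.
have -> : 4 * K * A ^+ 2 / (D * vtheta ^+ 2) * sigma ^+ 2 * J * log_ep p
    = 4 / vtheta * Z.
  by rewrite /Z lam2; field; rewrite !gt_eqF.
have H : 0 <= delta / 2 * Y by rewrite mulr_ge0// ltW// divr_gt0.
by rewrite mulrAC ler_pdivlMr//; lra.
Qed.
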